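(* Let $\varepsilon>0$. Then for every sufficiently large integer $n$ the following holds. Suppose that (i) $0<p:=p(n)<1$, and (ii) $a_1,\ldots,a_n$ are integers (the box sizes) such that $a_i\le \frac{(1-\varepsilon)\ln n}{-\ln(1-p)}$ for every $1\le i\le n$. Then BoxMaker has a polynomial-time strategy for the $p$-random-turn game $Box_p(a_1,\ldots,a_n)$ that w.h.p. leads him to win the game.
   Context: The $p$-random-turn game $Box_p(a_1,\ldots,a_n)$: the board is the disjoint union of $n$ sets (boxes) $F_1,\ldots,F_n$ with $|F_i|=a_i$. Two players, BoxMaker and BoxBreaker, claim previously unclaimed board elements. Before each turn a biased coin is tossed, independently of all other turns: with probability $p$ BoxBreaker plays this turn, and with probability $1-p$ BoxMaker plays it; the chosen player claims exactly one unclaimed element. The game lasts until all elements are claimed. BoxMaker wins if he claims all elements of some box; otherwise (i.e. if BoxBreaker claims at least one element of every box) BoxBreaker wins. A strategy of a player prescribes (possibly using randomization) his next move on the basis of the history of the game so far; it is polynomial-time if each move can be computed in time polynomial in the size of the board. ''W.h.p.'' means with probability tending to $1$ as $n\to\infty$ (over the coin tosses and any randomness of the strategy), against any strategy of the opponent. *)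

(* Defs.v *)
From HB Require Import structures.
From mathcomp Require Import all_boot all_order all_algebra.
From mathcomp Require Import all_classical all_reals all_analysis.

Set Implicit Arguments.
Unset Strict Implicit.
Unset Printing Implicit Defensive.

Import Order.TTheory GRing.Theory Num.Theory.
Import numFieldNormedType.Exports.

Local Open Scope ring_scope.

Notation player := bool (only parsing).
Definition BoxMaker : player := true.
Definition BoxBreaker : player := false.

(* Disjoint union of boxes F_i, with #|F_i| = a i. *)
Definition board (n : nat) (a : 'I_n -> nat) : finType := {i : 'I_n & 'I_(a i)}.

(* The boxes are counted as well as the elements, so that the size of the
   description of a board with empty boxes is bounded by [board_size]; when no
   box is empty, #|board a| <= board_size a <= 2 * #|board a|. *)
Definition board_size (n : nat) (a : 'I_n -> nat) : nat := (n + #|board a|)%N.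

(* Who played and what was claimed, in chronological order. *)
Definition history (n : nat) (a : 'I_n -> nat) := seq (player * board a).

Section Game.
Context {R : realType} {n : nat} {a : 'I_n -> nat}.
Implicit Types (h : history a) (x : board a).

Definition claimed h : seq (board a) := [seq m.2 | m <- h].

Definition ongoing h : bool := uniq (claimed h) && (size h < #|board a|)%N.

(* Randomized strategies: [s h x] is the probability of claiming x after h. *)
Definition strategy := history a -> board a -> R.

Definition legal (s : strategy) : Prop :=
  forall h, ongoing h ->
    [/\ forall x, 0 <= s h x,
        \sum_x s h x = 1
      & forall x, x \in claimed h -> s h x = 0].

Definition maker_wins h : bool :=
  [exists i : 'I_n, forall j : 'I_(a i),
     (BoxMaker, Tagged (fun i => 'I_(a i)) j) \in h].

Definition turn_prob (p : R) (maker breaker : strategy) h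
    (m : player * board a) : R :=
  if m.1 == BoxMaker then (1 - p) * maker h m.2 else p * breaker h m.2.

Definition play_prob (p : R) (maker breaker : strategy)
    (t : #|board a|.-tuple (player * board a)) : R :=
  \prod_(k < #|board a|) turn_prob p maker breaker (take k t) (tnth t k).

Definition maker_win_prob (p : R) (maker breaker : strategy) : R :=
  \sum_(t : #|board a|.-tuple (player * board a) | maker_wins t)
    play_prob p maker breaker t.

End Game.

Arguments strategy R {n} a.

(* Structured programs for a random access machine with a read-only input array
   and registers indexed by nat, under the uniform cost criterion. There is no
   multiplication, so that polynomial time on this machine is polynomial time on
   a Turing machine. *)
Inductive instr :=
| Const (r k : nat)    (* R[r] := k *)
| Add (r s t : nat)    (* R[r] := R[s] + R[t] *)
| Sub (r s t : nat)    (* R[r] := R[s] - R[t], truncated *)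
| Input (r s : nat)    (* R[r] := input[R[s]], or 0 beyond the input *)
| Fetch (r s : nat)    (* R[r] := R[R[s]] *)
| Store (r s : nat).   (* R[R[r]] := R[s] *)

Inductive program :=
| Do (i : instr)
| Seq (c1 c2 : program)
| If (r : nat) (c1 c2 : program)    (* tests R[r] != 0 *)
| While (r : nat) (c : program).    (* tests R[r] != 0 *)

Definition registers := nat -> nat.

Definition update (reg : registers) (r v : nat) : registers :=
  fun s => if s == r then v else reg s.

Definition exec_instr (inp : seq nat) (i : instr) (reg : registers) :
    registers :=
  match i with
  | Const r k => update reg r k
  | Add r s t => update reg r (reg s + reg t)%N
  | Sub r s t => update reg r (reg s - reg t)%N
  | Input r s => update reg r (nth 0%N inp (reg s))
  | Fetch r s => update reg r (reg (reg s))
  | Store r s => update reg (reg r) (reg s)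
  end.

(* [exec inp c reg t reg']: started in [reg], c halts in [reg'] after t steps. *)
Inductive exec (inp : seq nat) :
    program -> registers -> nat -> registers -> Prop :=
| ExecDo i reg : exec inp (Do i) reg 1 (exec_instr inp i reg)
| ExecSeq c1 c2 reg1 reg2 reg3 t1 t2 :
    exec inp c1 reg1 t1 reg2 -> exec inp c2 reg2 t2 reg3 ->
    exec inp (Seq c1 c2) reg1 (t1 + t2)%N reg3
| ExecIfTrue r c1 c2 reg t reg' :
    reg r != 0%N -> exec inp c1 reg t reg' ->
    exec inp (If r c1 c2) reg t.+1 reg'
| ExecIfFalse r c1 c2 reg t reg' :
    reg r = 0%N -> exec inp c2 reg t reg' ->
    exec inp (If r c1 c2) reg t.+1 reg'
| ExecWhileTrue r c reg1 reg2 reg3 t1 t2 :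
    reg1 r != 0%N -> exec inp c reg1 t1 reg2 ->
    exec inp (While r c) reg2 t2 reg3 ->
    exec inp (While r c) reg1 (t1 + t2).+1 reg3
| ExecWhileFalse r c reg :
    reg r = 0%N -> exec inp (While r c) reg 1 reg.

Definition encode_turn (n : nat) (a : 'I_n -> nat) (m : player * board a) :
    seq nat :=
  [:: nat_of_bool m.1; nat_of_ord (tag m.2); nat_of_ord (tagged m.2)].

(* Number of boxes, box sizes, length of the history, history, random bits. *)
Definition encode (n : nat) (a : 'I_n -> nat) (h : history a) (w : seq bool) :
    seq nat :=
  n :: [seq a i | i <- enum 'I_n] ++
  size h :: flatten [seq encode_turn m | m <- h] ++
  [seq nat_of_bool b | b <- w].

(* A single program plays on all boards. It gets as many uniform random bits as
   it has time steps, and returns the chosen element (i, j) in the registers 0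
   and 1; the strategy is the law of that element. *)
Definition polynomial_time (R : realType)
    (s : forall (n : nat) (a : 'I_n -> nat), strategy R a) : Prop :=
  exists (c : program) (T : {poly nat}),
  forall (n : nat) (a : 'I_n -> nat) (h : history a), ongoing h ->
    let l := T.[board_size a] in
    exists f : l.-tuple bool -> board a,
      (forall w : l.-tuple bool, exists (t : nat) (reg : registers),
         [/\ (t <= l)%N,
             exec (encode h w) c (fun=> 0%N) t reg,
             reg 0%N = tag (f w) :> nat
           & reg 1%N = tagged (f w) :> nat])
      /\ (forall x : board a,
            s n a h x = #|[set w | f w == x]|%:R / 2%:R ^+ l).

(* Main.v *)
(* Call a box live while Breaker owns none of its elements. Maker always claims an
   element of a live box with the largest number of claimed elements. Put
   q = 1 - p, m = max a_i, and let c_i be the number of claimed elements of box i.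
   As long as Maker has not won, the product of 1 - q^(m - c_i) over the live
   boxes i does not increase on average, whatever Breaker does; it equals 1 if
   Maker has lost. Hence Maker loses with probability at most its initial value
   (1 - q^m)^n <= exp(- n q^m) <= exp(- n^eps). *)

Require Import Defs.
From HB Require Import structures.
From mathcomp Require Import all_boot all_order all_algebra.
From mathcomp Require Import all_classical all_reals all_analysis.
From mathcomp Require Import zify ring lra.

Set Implicit Arguments.
Unset Strict Implicit.
Unset Printing Implicit Defensive.

Import Order.TTheory GRing.Theory Num.Theory.
Import numFieldNormedType.Exports.

Local Open Scope classical_set_scope.
Local Open Scope ring_scope.

(** * Averages over a finite distribution, and sums over tuples *)

Lemma mean_le (R : numDomainType) (T : finType) (f g : T -> R) (M : R) :
  (forall x, 0 <= f x) -> \sum_x f x = 1 -> (forall x, f x != 0 -> g x <= M) ->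
  \sum_x f x * g x <= M.
Proof.
move=> f0 f1 gM; rewrite -[leRHS]mul1r -f1 mulr_suml; apply: ler_sum => x _.
by case: (eqVneq (f x) 0) => [->|fx]; rewrite ?mul0r // ler_wpM2l // gM.
Qed.

Lemma big_tuple_cons (V : nmodType) (T : finType) (l : nat)
    (F : l.+1.-tuple T -> V) :
  \sum_t F t = \sum_x \sum_(t : l.-tuple T) F [tuple of x :: t].
Proof.
rewrite pair_bigA /=.
rewrite (reindex (fun xt : T * l.-tuple T => [tuple of xt.1 :: xt.2])) //.
exists (fun t => (thead t, behead_tuple t)) => [[x t] _|t _] /=.
  by rewrite theadE; congr (_, _); apply: val_inj.
by rewrite -tuple_eta.
Qed.

(** * Scores of cells and Maker's best moves *)

Section Scores.
Context {n : nat} {a : 'I_n -> nat}.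
Implicit Types (h : history a) (m : player * board a).

(** Box and cell indices are natural numbers here, so that these counts can be compared directly
    with register contents. *)
Definition box_count h (i : nat) : nat := count (fun m => tag m.2 == i :> nat) h.

Definition breaker_count h (i : nat) : nat :=
  count (fun m => ~~ m.1 && (tag m.2 == i :> nat)) h.

Definition cell_count h (i j : nat) : nat :=
  count (fun m => (tag m.2 == i :> nat) && (tagged m.2 == j :> nat)) h.

(** Maximizing this encodes Maker's rule: 0 marks a claimed cell, 1 a free cell of a dead box, and
    the offset 2 ranks every live box above all dead ones. *)
Definition score h (i j : nat) : nat :=
  if cell_count h i j != 0%N then 0%N
  else if breaker_count h i != 0%N then 1%N else (2 + box_count h i)%N.

Definition best_move h (x : board a) : Prop :=
  (0 < score h (tag x) (tagged x))%N /\
  forall y : board a,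
    (score h (tag y) (tagged y) <= score h (tag x) (tagged x))%N.

Lemma cell_countE h (x : board a) :
  (cell_count h (tag x) (tagged x) != 0%N) = (x \in claimed h).
Proof.
rewrite -lt0n -has_count; apply/hasP/mapP => [[m mh /andP[/eqP e1 /eqP e2]]|].
  exists m => //; case: m mh e1 e2 => b [i j] /= mh e1 e2.
  case: x e1 e2 => i' j' /= /val_inj e1; subst i' => /val_inj e2.
  by rewrite e2.
by move=> [m mh ->]; exists m => //; rewrite !eqxx.
Qed.

Lemma score_gt0 h (x : board a) :
  (0 < score h (tag x) (tagged x))%N = (x \notin claimed h).
Proof.
by rewrite /score cell_countE; case: (x \in _) => //=; case: ifP.
Qed.

Lemma best_move_unclaimed h x : best_move h x -> x \notin claimed h.
Proof. by case=> + _; rewrite score_gt0. Qed.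

Lemma box_count_rcons h m (i : nat) :
  box_count (rcons h m) i = (box_count h i + (tag m.2 == i :> nat))%N.
Proof. by rewrite /box_count -cats1 count_cat /= addn0. Qed.

Lemma breaker_count_rcons h m (i : nat) :
  breaker_count (rcons h m) i =
    (breaker_count h i + (~~ m.1 && (tag m.2 == i :> nat)))%N.
Proof. by rewrite /breaker_count -cats1 count_cat /= addn0. Qed.

(** As Maker has not won, some cell of the box is not his; were it claimed, it would be Breaker's,
    and the box would be dead. An empty box counts as won, so it cannot occur here. *)
Lemma live_has_unclaimed h (i : 'I_n) :
  ~~ maker_wins h -> breaker_count h i = 0%N ->
  exists2 x : board a, tag x = i & x \notin claimed h.
Proof.
move=> lose live.
move/existsPn: lose => /(_ i) /forallPn[j jh].
exists (Tagged (fun k : 'I_n => 'I_(a k)) j) => //.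
apply: contra jh => /mapP[[b y] mh /= e].
case: b mh => mh; first by rewrite e.
move/eqP: live; rewrite eqn0Ngt -has_count => /hasPn/(_ _ mh) /=.
by rewrite -e /= eqxx.
Qed.

(** The claimed cells of the box together with [x] are distinct, and their indices lie below
    [a (tag x)]. *)
Lemma box_count_lt h (x : board a) :
  uniq (claimed h) -> x \notin claimed h -> (box_count h (tag x) < a (tag x))%N.
Proof.
move=> uh xh.
pose s := [seq y <- x :: claimed h | tag y == tag x].
have us : uniq s by rewrite filter_uniq //= xh.
have -> : box_count h (tag x) = (size s).-1.
  by rewrite /s /= eqxx /= size_filter /claimed count_map.
suff : (size s <= a (tag x))%N by rewrite /s /= eqxx.
rewrite -[leqRHS](size_iota 0) -(size_map (fun y : board a => val (tagged y))).
apply: uniq_leq_size.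
  rewrite map_inj_in_uniq // => -[i1 j1] [i2 j2].
  rewrite !mem_filter /= => /andP[/eqP e1 _] /andP[/eqP e2 _].
  by subst i1 i2 => /val_inj ->.
move=> k /mapP[[i j]]; rewrite mem_filter /= => /andP[/eqP e _] ->.
by subst i; rewrite mem_iota /= ltn_ord.
Qed.

(** A free cell of the live box [i] scores [2 + box_count h i], which no cell of a dead box
    reaches. *)
Lemma best_move_live h x (i : 'I_n) :
  ~~ maker_wins h -> best_move h x -> breaker_count h i = 0%N ->
  breaker_count h (tag x) = 0%N /\ (box_count h i <= box_count h (tag x))%N.
Proof.
move=> lose [x0 xmax] live.
have [y yi yh] := live_has_unclaimed lose live.
have := xmax y; rewrite /score cell_countE (negbTE yh) /= yi live /=.
case: (_ == 0%N) => //=; case: (eqVneq (breaker_count h (tag x)) 0%N) => //=.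
Qed.

End Scores.

(** * The potential of a position *)

Section Potential.
Context {R : realType} {n : nat} {a : 'I_n -> nat}.
Implicit Types (h : history a).
Variables (p : R) (maker breaker : strategy R a) (b : nat).
Hypothesis p_gt0 : 0 < p.
Hypothesis p_lt1 : p < 1.
Hypothesis ab : forall i, (a i <= b)%N.
Hypothesis maker_legal : legal maker.
Hypothesis breaker_legal : legal breaker.
Hypothesis maker_best :
  forall h x, ongoing h -> maker h x != 0 -> best_move h x.

(** The probability that Breaker gets at least one of [b - box_count h i] independent turns. The
    common bound [b] replaces the size of the box, so that the fullest live box is the one of
    smallest risk. *)
Definition box_risk h (i : nat) : R := 1 - (1 - p) ^+ (b - box_count h i).

Definition potential h : R :=
  \prod_(i < n | breaker_count h i == 0%N) box_risk h i.

Lemma box_risk_ge0 h i : 0 <= box_risk h i.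
Proof. by rewrite subr_ge0 exprn_ile1 //; move: p_gt0 p_lt1; lra. Qed.

Lemma box_risk_le1 h i : box_risk h i <= 1.
Proof. by rewrite gerBl exprn_ge0 //; move: p_lt1; lra. Qed.

Lemma potential_ge0 h : 0 <= potential h.
Proof. by apply: prodr_ge0 => i _; exact: box_risk_ge0. Qed.

Lemma potential_le1 h : potential h <= 1.
Proof.
suff /andP[] : 0 <= potential h <= 1 by [].
rewrite /potential.
apply: (big_ind (fun z : R => 0 <= z <= 1)) => [|y z /andP[? ?] /andP[? ?]|i _].
- by rewrite ler01 lexx.
- by rewrite mulr_ge0 //= mulr_ile1.
- by rewrite box_risk_ge0 box_risk_le1.
Qed.

Lemma box_risk_other h (x : board a) i : (tag x == i :> nat) = false ->
  forall c, box_risk (rcons h (c, x)) i = box_risk h i.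
Proof. by move=> e c; rewrite /box_risk box_count_rcons /= e addn0. Qed.

Definition other_potential h (k : 'I_n) : R :=
  \prod_(i < n | (breaker_count h i == 0%N) && (i != k)) box_risk h i.

Lemma other_potentialE h (k : 'I_n) c (x : board a) : tag x = k ->
  \prod_(i < n | (breaker_count (rcons h (c, x)) i == 0%N) && (i != k))
     box_risk (rcons h (c, x)) i = other_potential h k.
Proof.
move=> xk; apply: eq_big => [i|i /andP[_ ik]].
  rewrite breaker_count_rcons /= xk.
  case: (eqVneq i k) => [->|ik]; first by rewrite !andbF.
  by rewrite [k == i :> nat]eq_sym val_eqE (negbTE ik) !andbF addn0.
by rewrite box_risk_other // xk eq_sym val_eqE (negbTE ik).
Qed.

Lemma potential_live h (k : 'I_n) :
  breaker_count h k = 0%N -> potential h = box_risk h k * other_potential h k.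
Proof. by move=> live; rewrite /potential (bigD1 k) //= live. Qed.

Lemma potential_dead h (k : 'I_n) :
  breaker_count h k != 0%N -> potential h = other_potential h k.
Proof.
move=> dead; apply: eq_bigl => i; case: (eqVneq i k) => [->|]; last first.
  by rewrite andbT.
by rewrite (negbTE dead).
Qed.

(** Breaker's turn leaves the box dead whatever its state before, so its factor is absent
    afterwards. *)
Lemma potential_breaker h (x : board a) :
  potential (rcons h (BoxBreaker, x)) = other_potential h (tag x).
Proof.
rewrite (@potential_dead _ (tag x)) ?breaker_count_rcons /= ?eqxx ?addn1 //.
exact: other_potentialE.
Qed.

Lemma potential_maker h (x : board a) : breaker_count h (tag x) = 0%N ->
  potential (rcons h (BoxMaker, x)) =
    box_risk (rcons h (BoxMaker, x)) (tag x) * other_potential h (tag x).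
Proof.
move=> live; rewrite (@potential_live _ (tag x)).
  by congr (_ * _); exact: other_potentialE.
by rewrite breaker_count_rcons live.
Qed.

Lemma sum_turn_prob h (g : player * board a -> R) :
  \sum_m turn_prob p maker breaker h m * g m =
    (1 - p) * (\sum_x maker h x * g (BoxMaker, x)) +
    p * (\sum_x breaker h x * g (BoxBreaker, x)).
Proof.
transitivity (\sum_c \sum_x turn_prob p maker breaker h (c, x) * g (c, x)).
  by rewrite pair_bigA; apply: eq_bigr => -[].
rewrite big_bool /= !mulr_sumr; congr (_ + _); apply: eq_bigr => x _;
  by rewrite /turn_prob /= mulrA.
Qed.

Lemma turn_prob_ge0 h m : ongoing h -> 0 <= turn_prob p maker breaker h m.
Proof.
move=> oh; rewrite /turn_prob.
have [/(_ m.2) m0 _ _] := maker_legal oh.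
have [/(_ m.2) b0 _ _] := breaker_legal oh.
by case: ifP => _; rewrite mulr_ge0 //; move: p_gt0 p_lt1; lra.
Qed.

Lemma turn_prob_claimed h m : ongoing h -> m.2 \in claimed h ->
  turn_prob p maker breaker h m = 0.
Proof.
move=> oh mh; rewrite /turn_prob.
have [_ _ /(_ _ mh) ->] := maker_legal oh.
have [_ _ /(_ _ mh) ->] := breaker_legal oh.
by rewrite !mulr0 if_same.
Qed.

Lemma turn_prob_sum1 h : ongoing h ->
  \sum_m turn_prob p maker breaker h m = 1.
Proof.
move=> oh.
have [_ m1 _] := maker_legal oh; have [_ b1 _] := breaker_legal oh.
under eq_bigr => m _ do rewrite -[turn_prob _ _ _ _ _]mulr1.
rewrite (sum_turn_prob h (fun=> 1)).
under eq_bigr => m _ do rewrite mulr1.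
under [X in _ + _ * X]eq_bigr => m _ do rewrite mulr1.
by rewrite m1 b1; ring.
Qed.

(* With [u] the smallest box risk, attained where Maker plays, a Maker turn
   multiplies the potential by [(u - p) / ((1 - p) * u)] and a Breaker turn by
   at most [1 / u]; these factors average to [1]. *)
Lemma potential_step h : ongoing h -> ~~ maker_wins h ->
  \sum_m turn_prob p maker breaker h m * potential (rcons h m) <= potential h.
Proof.
move=> oh lose; rewrite sum_turn_prob.
have [m0 m1 _] := maker_legal oh; have [b0 b1 _] := breaker_legal oh.
have [x mx] : exists x, maker h x != 0.
  apply: contrapT => /forallNP mz; move: m1; rewrite big1 => [/eqP|x _].
    by rewrite eq_sym oner_eq0.
  by apply/eqP/negPn/negP; exact: mz.
have q0 : 0 <= 1 - p by move: p_lt1; lra.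
have bx := maker_best oh mx.
(* A best move in a dead box means that no box is live; the potential is then an empty product,
   already at its maximum 1. *)
case: (eqVneq (breaker_count h (tag x)) 0%N) => [livex|deadx]; last first.
  have -> : potential h = 1.
    rewrite /potential big_pred0 // => i; apply/negbTE/negP => /eqP live.
    by have [] := best_move_live lose bx live; move/eqP: deadx.
  have M : \sum_x maker h x * potential (rcons h (BoxMaker, x)) <= 1.
    by apply: mean_le => // y _; exact: potential_le1.
  have B : \sum_x breaker h x * potential (rcons h (BoxBreaker, x)) <= 1.
    by apply: mean_le => // y _; exact: potential_le1.
  have := ler_wpM2l q0 M; have := ler_wpM2l (ltW p_gt0) B; lra.
set u := box_risk h (tag x).
have xlt : (box_count h (tag x) < b)%N.
  apply: leq_trans (ab (tag x)); apply: box_count_lt.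
    by case/andP: oh.
  exact: best_move_unclaimed.
(* At least one more turn is counted in such a risk, and Breaker gets that turn with probability
   [p]. This makes [u] positive, hence invertible. *)
have risk_gt i : (box_count h i < b)%N -> p <= box_risk h i.
  rewrite /box_risk -subn_gt0; case: (_ - _)%N => // r _.
  have : (1 - p) ^+ r <= 1 by apply: exprn_ile1 => //; move: p_gt0; lra.
  by move/(ler_wpM2l q0); rewrite -exprS; lra.
have u_gt0 : 0 < u by apply: lt_le_trans (risk_gt _ xlt).
(* Maker may randomize, but all his best moves lie in live boxes with equal counts, so one factor
   serves for all of them. *)
have maker_bound y : maker h y != 0 ->
    potential (rcons h (BoxMaker, y)) <= (u - p) / ((1 - p) * u) * potential h.
  move=> /(maker_best oh) by_.
  have [livey xy] := best_move_live lose by_ livex.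
  have [_ yx] := best_move_live lose bx livey.
  have cxy : box_count h (tag y) = box_count h (tag x) by apply/eqP; rewrite eqn_leq yx.
  rewrite potential_maker // (potential_live livey).
  have -> : box_risk h (tag y) = u by rewrite /u /box_risk cxy.
  rewrite /box_risk box_count_rcons /= eqxx cxy.
  rewrite le_eqVlt; apply/orP; left; apply/eqP.
  have ue : u = 1 - (1 - p) * (1 - p) ^+ (b - (box_count h (tag x) + 1)).
    by rewrite /u /box_risk -exprS; congr (1 - _ ^+ _); lia.
  move: u_gt0; rewrite ue => u0'.
  have u0'' := lt0r_neq0 u0'.
  have : 1 - p != 0 by apply: lt0r_neq0; move: p_lt1; lra.
  move=> q00; field; first by rewrite q00 u0''.
(* Killing a live box removes a factor that is at least [u]; a turn in a dead box leaves the
   potential unchanged, and [u] is at most 1. *)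
have breaker_bound y : potential (rcons h (BoxBreaker, y)) <= u^-1 * potential h.
  rewrite potential_breaker ler_pdivlMl //.
  case: (eqVneq (breaker_count h (tag y)) 0%N) => [live|dead].
    rewrite (potential_live live) ler_wpM2r //.
      by apply: prodr_ge0 => i _; exact: box_risk_ge0.
    have [_ cyx] := best_move_live lose bx live.
    rewrite /u /box_risk lerD2l lerN2.
    rewrite ler_wiXn2l //; first by move: p_gt0; lra.
    by rewrite leq_sub2l.
  rewrite -(potential_dead dead) -[leRHS]mul1r ler_wpM2r ?potential_ge0 //.
  exact: box_risk_le1.
have := mean_le m0 m1 maker_bound.
have := mean_le b0 b1 (fun y _ => breaker_bound y).
move=> /(ler_wpM2l (ltW p_gt0)) B /(ler_wpM2l q0) M.
apply: le_trans (lerD M B) _.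
rewrite le_eqVlt; apply/orP; left; apply/eqP.
have q00 : 1 - p != 0 by apply: lt0r_neq0; move: p_lt1; lra.
by field; rewrite q00 lt0r_neq0.
Qed.

(** Freezing the value at 1 once Maker has won gives a submartingale on all ongoing positions,
    whereas [potential_step] covers only those where he has not won. *)
Definition win_bound h : R := if maker_wins h then 1 else 1 - potential h.

Lemma win_bound_ge h : 1 - potential h <= win_bound h.
Proof. by rewrite /win_bound; case: ifP => // _; rewrite gerBl potential_ge0. Qed.

Lemma maker_wins_rcons h m : maker_wins h -> maker_wins (rcons h m).
Proof.
move=> /existsP[i /forallP wi]; apply/existsP; exists i; apply/forallP => j.
by rewrite mem_rcons inE wi orbT.
Qed.

Lemma win_bound_step h : ongoing h ->
  win_bound h <= \sum_m turn_prob p maker breaker h m * win_bound (rcons h m).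
Proof.
move=> oh; rewrite {1}/win_bound; case: ifPn => [win|lose].
  rewrite -(turn_prob_sum1 oh); apply: ler_sum => m _.
  by rewrite /win_bound maker_wins_rcons // mulr1.
apply: (@le_trans _ _
    (\sum_m turn_prob p maker breaker h m * (1 - potential (rcons h m)))).
  under eq_bigr => m _ do rewrite mulrBr mulr1.
  by rewrite sumrB turn_prob_sum1 // lerD2l lerN2 potential_step.
by apply: ler_sum => m _; rewrite ler_wpM2l ?turn_prob_ge0 ?win_bound_ge.
Qed.

(** On a full board without a Maker win, every box contains a cell of Breaker, so the potential is
    an empty product. *)
Lemma win_bound_final h :
  uniq (claimed h) -> size h = #|board a| ->
  win_bound h <= (maker_wins h)%:R.
Proof.
move=> uh sh; rewrite /win_bound; case: ifPn => // lose.
suff -> : potential h = 1 by rewrite subrr.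
rewrite /potential big_pred0 // => i; apply/negbTE/negP => /eqP live.
have [x _ /negP[]] := live_has_unclaimed lose live.
have /uniq_min_size : {subset claimed h <= enum (board a)}.
  by move=> y _; rewrite mem_enum.
by case/(_ uh) => [|_ ->]; rewrite ?mem_enum // -cardE size_map sh.
Qed.

(** Iterates [win_bound_step] over the [l] remaining turns; an arbitrary starting history is what
    the induction requires. *)
Lemma win_bound_le (l : nat) h : uniq (claimed h) -> (size h + l)%N = #|board a| ->
  win_bound h <= \sum_(t : l.-tuple (player * board a))
    (\prod_(i < l) turn_prob p maker breaker (h ++ take i t) (tnth t i)) *
    (maker_wins (h ++ t))%:R.
Proof.
elim: l h => [|l IH] h uh sh.
  rewrite (big_pred1 [tuple]) => [|t]; last by rewrite (tuple0 t); apply/esym/eqP.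
  rewrite big_ord0 mul1r cats0; apply: win_bound_final => //.
  by rewrite -sh addn0.
have oh : ongoing h by rewrite /ongoing uh -sh addnS ltnS leq_addr.
apply: le_trans (win_bound_step oh) _.
rewrite big_tuple_cons; apply: ler_sum => m _.
(* The induction hypothesis does not apply after a repeated cell, but legality gives such a turn
   probability 0. *)
case: (boolP (m.2 \in claimed h)) => [mh|mh].
  rewrite turn_prob_claimed // mul0r sumr_ge0 // => t _.
  by rewrite big_ord_recl /= cats0 (tnth0 m) turn_prob_claimed // !mul0r.
under eq_bigr => t _.
  rewrite big_ord_recl /= cats0 (tnth0 m) -mulrA -cat_rcons.
  under eq_bigr => i _ do rewrite -cat_rcons tnthS.
  over.
rewrite -mulr_sumr ler_wpM2l ?turn_prob_ge0 //; apply: IH.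
  by rewrite /claimed map_rcons rcons_uniq mh.
by rewrite size_rcons addSnnS.
Qed.

Lemma maker_win_prob_ge :
  1 - (1 - (1 - p) ^+ b) ^+ n <= maker_win_prob p maker breaker.
Proof.
have := @win_bound_le #|board a| [::] isT (add0n _).
rewrite [X in _ <= X](_ : _ = maker_win_prob p maker breaker); last first.
  rewrite /maker_win_prob [RHS]big_mkcond /=; apply: eq_bigr => t _.
  by case: ifP => _; rewrite ?mulr1 ?mulr0.
apply: le_trans; apply: le_trans (win_bound_ge [::]).
by rewrite /potential /box_risk /= prodr_const card_ord subn0.
Qed.

End Potential.

(** * Computing a best move in polynomial time *)

Section Machine.
Local Open Scope nat_scope.
Variable inp : seq nat.

(** The first instruction is a separate argument because there is no empty program. *)
Fixpoint block (i : instr) (s : seq instr) : program :=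
  if s is i' :: s' then Seq (Do i) (block i' s') else Do i.

Lemma exec_block i s reg :
  exec inp (block i s) reg (size s).+1
    (foldl (fun g k => exec_instr inp k g) reg (i :: s)).
Proof.
elim: s i reg => [|i' s IH] i reg /=; first exact: ExecDo.
by rewrite -add1n; apply: ExecSeq; [exact: ExecDo | exact: IH].
Qed.

(** Total correctness with a time bound; the lemmas on it below act as Hoare rules. *)
Definition halts (c : program) (reg : registers) (T : nat)
    (Q : registers -> Prop) : Prop :=
  exists t reg', [/\ (t <= T), exec inp c reg t reg' & Q reg'].

Lemma halts_weaken c reg T T' (Q Q' : registers -> Prop) :
  halts c reg T Q -> (T <= T') -> (forall reg', Q reg' -> Q' reg') ->
  halts c reg T' Q'.
Proof.
move=> [t [reg' [tT e q]]] TT' QQ'; exists t, reg'; split=> //; last exact: QQ'.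
exact: leq_trans tT TT'.
Qed.

(* Symbolic execution on the first registers: as a list of values, the state is
   evaluated once per instruction, whereas nested [update]s grow exponentially. *)
Definition input_value (k : nat) : nat := nth 0 inp k.

Definition exec_file (f : seq nat) (i : instr) : seq nat :=
  match i with
  | Const r k => set_nth 0 f r k
  | Add r s t => set_nth 0 f r (nth 0 f s + nth 0 f t)
  | Defs.Sub r s t => set_nth 0 f r (nth 0 f s - nth 0 f t)
  | Input r s => set_nth 0 f r (input_value (nth 0 f s))
  | _ => f
  end.

(** Excludes [Fetch] and [Store], whose addresses are known only at run time and which [exec_file]
    does not model. *)
Definition direct_within (k : nat) (i : instr) : bool :=
  match i with
  | Const r _ => r < k
  | Add r s t | Defs.Sub r s t => [&& r < k, s < k & t < k]
  | Input r s => (r < k) && (s < k)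
  | _ => false
  end.

Lemma mkseq_update k reg r v : r < k ->
  mkseq (update reg r v) k = set_nth 0 (mkseq reg k) r v.
Proof.
move=> rk; apply: (@eq_from_nth _ 0) => [|j].
  by rewrite size_set_nth !size_mkseq; apply/esym/maxn_idPr.
rewrite size_mkseq => jk; rewrite nth_set_nth /= !nth_mkseq //.
Qed.

Lemma mkseq_exec_instr k reg i : direct_within k i ->
  mkseq (exec_instr inp i reg) k = exec_file (mkseq reg k) i.
Proof.
case: i => //= [r v|r s t|r s t|r s].
- exact: mkseq_update.
- by case/and3P=> rk sk tk; rewrite mkseq_update // !nth_mkseq.
- by case/and3P=> rk sk tk; rewrite mkseq_update // !nth_mkseq.
- by case/andP=> rk sk; rewrite mkseq_update // !nth_mkseq.
Qed.

Lemma halts_block k i s reg (Q : registers -> Prop) :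
  all (direct_within k) (i :: s) ->
  (forall reg', mkseq reg' k = foldl exec_file (mkseq reg k) (i :: s) ->
     Q reg') ->
  halts (block i s) reg (size s).+1 Q.
Proof.
move=> wf q; exists (size s).+1; eexists.
split; [exact: leqnn | exact: exec_block | apply: q].
elim: (i :: s) wf reg => //= i' s' IH /andP[i'k s'k] reg.
by rewrite IH // mkseq_exec_instr.
Qed.

Lemma halts_seq c1 c2 reg T1 T2 (Q1 Q2 : registers -> Prop) :
  halts c1 reg T1 Q1 -> (forall reg', Q1 reg' -> halts c2 reg' T2 Q2) ->
  halts (Seq c1 c2) reg (T1 + T2) Q2.
Proof.
move=> [t1 [reg1 [tT1 e1 /[swap] q12 /q12 [t2 [reg2 [tT2 e2 q2]]]]]].
exists (t1 + t2), reg2; split=> //; first exact: leq_add.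
exact: ExecSeq e1 e2.
Qed.

Lemma halts_if r c1 c2 reg T (Q : registers -> Prop) :
  (reg r != 0 -> halts c1 reg T Q) -> (reg r = 0 -> halts c2 reg T Q) ->
  halts (If r c1 c2) reg T.+1 Q.
Proof.
move=> h1 h2; case: (eqVneq (reg r) 0) => [r0|r0].
  by have [t [reg' [tT e q]]] := h2 r0; exists t.+1, reg'; split => //; apply: ExecIfFalse.
by have [t [reg' [tT e q]]] := h1 r0; exists t.+1, reg'; split => //; apply: ExecIfTrue.
Qed.

(** The counter register is the loop variant and indexes the invariant. Each of the [k] rounds costs
    the body and one test, and the failing test adds 1. *)
Lemma halts_while r c T k (I : nat -> registers -> Prop) :
  (forall i reg, I i reg -> reg r = i) ->
  (forall i reg, (i < k) -> I i.+1 reg -> halts c reg T (I i)) ->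
  forall reg, I k reg -> halts (While r c) reg (k * T.+1 + 1) (I 0).
Proof.
move=> Ir; elim: k => [|k IH] step reg Ik.
  by exists 1, reg; split=> //; apply: ExecWhileFalse; exact: Ir Ik.
have [t1 [reg1 [tT1 e1 I1]]] := step k reg (ltnSn k) Ik.
have [|t2 [reg2 [tT2 e2 I2]]] := IH _ reg1 I1.
  by move=> i reg' ik; apply: step; exact: ltnW.
exists (t1 + t2).+1, reg2; split=> //; first by rewrite mulSn; lia.
by apply: ExecWhileTrue e1 e2; rewrite (Ir _ _ Ik).
Qed.

End Machine.

(** Evaluates the register file only: arithmetic and [input_value] stay symbolic. *)
Ltac run_block :=
  cbv [foldl exec_file mkseq map iota nth set_nth ncons iter].
Ltac same_tac :=
  rewrite !inE; repeat (case/predU1P=> [->|]; [congruence|]); move/eqP->;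
  congruence.

(** * The program: nested loops over boxes, cells and past turns *)

Section Program.
Local Open Scope nat_scope.

(* Registers: 0 and 1 hold the best cell so far and 2 its score; 3, 4 and 5 are
   loop counters, for the current box, the current index and the remaining
   history; 6 points into the input; 7, 8 and 9 count the turns in the current
   cell, Breaker's turns in the current box and all turns in it; 14 holds 1 and
   15 holds 0. *)
Definition scan_turn : program :=
  block (Defs.Sub 5 5 14)
    [:: Input 10 6; Add 6 6 14; Input 11 6; Add 6 6 14; Input 12 6; Add 6 6 14;
        Defs.Sub 13 11 3; Defs.Sub 16 3 11; Add 11 13 16;
        Defs.Sub 13 12 4; Defs.Sub 16 4 12; Add 12 13 16;
        Add 12 12 11; Defs.Sub 12 14 12; Add 7 7 12;
        Add 10 10 11; Defs.Sub 10 14 10; Add 8 8 10;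
        Defs.Sub 11 14 11; Add 9 9 11].

(** Input position 0 holds the number [n] of boxes and positions 1 to [n] their sizes, so the length
    of the history is at [n + 1] and its first turn at [n + 2]. *)
Definition init_scan : program :=
  block (Defs.Sub 4 4 14)
    [:: Const 7 0; Const 8 0; Const 9 0; Input 6 15; Add 6 6 14; Input 5 6;
        Add 6 6 14].

(** The score of a free cell in a live box is computed first, then overwritten in the other cases.
    Clearing the scratch register 11 stands for an empty branch. *)
Definition compute_score : program :=
  Seq (block (Const 10 2) [:: Add 10 10 9])
    (Seq (If 8 (block (Const 10 1) [::]) (block (Const 11 0) [::]))
      (If 7 (block (Const 10 0) [::]) (block (Const 11 0) [::]))).

Definition keep_best : program :=
  Seq (block (Defs.Sub 11 10 2) [::])
    (If 11 (block (Add 2 10 15) [:: Add 0 3 15; Add 1 4 15])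
      (block (Const 11 0) [::])).

Definition scan_cell : program :=
  Seq init_scan (Seq (While 5 scan_turn) (Seq compute_score keep_best)).

Definition scan_box : program :=
  Seq (block (Defs.Sub 3 3 14) [:: Add 10 3 14; Input 4 10]) (While 4 scan_cell).

Definition best_move_program : program :=
  Seq (block (Const 14 1) [:: Input 3 15]) (While 3 scan_box).

End Program.

(** * Correctness and running time of the program *)

Section Correctness.
Local Open Scope nat_scope.
Context {n : nat} {a : 'I_n -> nat}.
Variables (h : history a) (w : seq bool).

Let inp := encode h w.
Let sizes := [seq a i | i <- enum 'I_n].

(* The box sizes as a function on nat, with junk value 0 beyond [n]. *)
Definition box_size (i : nat) : nat := nth 0 sizes i.

Lemma box_sizeE (i : 'I_n) : box_size i = a i.
Proof.
by rewrite /box_size /sizes (nth_map i) ?size_enum_ord // nth_ord_enum.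
Qed.

Lemma encode_box i : (i < n) -> nth 0 inp i.+1 = box_size i.
Proof. by move=> i_n; rewrite /= nth_cat size_map size_enum_ord i_n. Qed.

Lemma encode_history :
  drop n.+1 inp =
    size h :: flatten [seq encode_turn m | m <- h] ++ [seq nat_of_bool b | b <- w].
Proof. by rewrite /= drop_size_cat // size_map size_enum_ord. Qed.

Definition same_on (s : seq nat) (g g' : registers) : Prop :=
  forall r, r \in s -> g r = g' r.

Lemma same_on_trans s g1 g2 g3 :
  same_on s g1 g2 -> same_on s g2 g3 -> same_on s g1 g3.
Proof. by move=> g12 g23 r rs; rewrite g12 // g23. Qed.

(** Here [h1] is already scanned and [h2] is not. Register 6 is described through the input suffix
    it points to, which avoids computing offsets. *)
Definition scan_inv (i j : nat) (reg0 : registers) (k : nat) (reg : registers) :=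
  exists h1 h2 : history a,
    [/\ h = h1 ++ h2, reg 5 = k, k = size h2,
        drop (reg 6) inp = flatten [seq encode_turn m | m <- h2] ++
                           [seq nat_of_bool b | b <- w]
      & [/\ reg 7 = cell_count h1 i j, reg 8 = breaker_count h1 i,
            reg 9 = box_count h1 i & same_on [:: 0; 1; 2; 3; 4; 14; 15] reg reg0]].

(** With truncated subtraction, this sum is the absolute difference; [scan_turn] tests equality by
    it and [one_subE] turns the test into 0 or 1. *)
Lemma absdiff_eq0 (x y : nat) : (x == y) = (x - y + (y - x) == 0).
Proof. by apply/idP/idP => /eqP; lia. Qed.

Lemma one_subE (x : nat) : (1 - x = (x == 0)).
Proof. by case: x. Qed.

Lemma scan_turn_correct reg0 k reg :
  reg0 14 = 1 -> scan_inv (reg0 3) (reg0 4) reg0 k.+1 reg ->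
  halts inp scan_turn reg 21 (scan_inv (reg0 3) (reg0 4) reg0 k).
Proof.
move=> r14 [h1 [h2 [hE r5 kE inE [r7 r8 r9 same]]]].
case: h2 kE hE inE => // m h2 [kE] hE inE.
have s3 : reg 3 = reg0 3 by apply: same.
have s4 : reg 4 = reg0 4 by apply: same.
have s14 : reg 14 = 1 by rewrite same.
have i0 : input_value inp (reg 6) = m.1.
  by rewrite /input_value -[reg 6]addn0 -nth_drop inE.
have i1 : input_value inp (reg 6 + 1) = tag m.2.
  by rewrite /input_value -nth_drop inE.
have i2 : input_value inp (reg 6 + 1 + 1) = tagged m.2.
  by rewrite /input_value -addnA -nth_drop inE.
(* The whole program uses only registers 0 to 16. *)
apply: (@halts_block _ 17) => // g; run_block.
move=> [g0 g1 g2 g3 g4 g5 g6 g7 g8 g9 _ _ _ _ g14 g15 _].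
move: g5 g6 g7 g8 g9; rewrite s14 i0 i1 i2 s3 s4 r7 r8 r9 !one_subE !addn_eq0.
move=> g5 g6 g7 g8 g9.
exists (rcons h1 m), h2; split.
- by rewrite cat_rcons.
- by rewrite g5 r5 kE subn1.
- by [].
- by rewrite g6 -!addnA addnC -drop_drop inE /= drop0.
split; [rewrite g7|rewrite g8|rewrite g9|].
- rewrite /cell_count -cats1 count_cat /= addn0.
  rewrite [tag m.2 == _ :> nat]absdiff_eq0 [tagged m.2 == _ :> nat]absdiff_eq0.
  by rewrite !addn_eq0 andbC.
- rewrite breaker_count_rcons [tag m.2 == _ :> nat]absdiff_eq0 addn_eq0.
  by case: (m.1); rewrite /= ?andbF ?andbT.
- by rewrite box_count_rcons [tag m.2 == _ :> nat]absdiff_eq0 addn_eq0.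
- by apply: same_on_trans same => r; same_tac.
Qed.

(** [V] holds of the cells scanned so far. While register 2 is 0, no free cell has been met and
    registers 0 and 1 need not describe a cell. *)
Definition best_inv (V : board a -> Prop) (reg : registers) : Prop :=
  (reg 2 = 0 \/ exists x : board a,
     [/\ reg 0 = tag x, reg 1 = tagged x & reg 2 = score h (tag x) (tagged x)]) /\
  forall y : board a, V y -> score h (tag y) (tagged y) <= reg 2.

Definition scan_state (i : nat) (V : board a -> Prop) (reg : registers) : Prop :=
  [/\ reg 3 = i, reg 14 = 1, reg 15 = 0 & best_inv V reg].

Lemma scan_state_same i V g g' : same_on [:: 0; 1; 2; 3; 14; 15] g' g ->
  scan_state i V g -> scan_state i V g'.
Proof.
move=> same [g3 g14 g15 best]; split; rewrite ?same //.
by move: best; rewrite /best_inv !same.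
Qed.

(** Register 4 starts one above the index because the loop decrements its counter before using
    it. *)
Lemma init_scan_correct (x : board a) V reg :
  scan_state (tag x) V reg -> reg 4 = (tagged x).+1 ->
  halts inp init_scan reg 8 (fun reg' =>
    [/\ scan_state (tag x) V reg', reg' 4 = tagged x
      & scan_inv (tag x) (tagged x) reg' (size h) reg']).
Proof.
move=> st r4; have [_ r14 r15 _] := st.
have r0 : input_value inp 0 = n by [].
have rn : input_value inp (n + 1) = size h.
  by rewrite /input_value addn1 -[n.+1]addn0 -nth_drop encode_history.
apply: (@halts_block _ 17) => // g; run_block.
rewrite r15 r14 r0 rn => -[g0 g1 g2 g3 g4 g5 g6 g7 g8 g9 _ _ _ _ g14 g15 _].
split.
- by apply: scan_state_same st => r; same_tac.
- by rewrite g4 r4 subn1.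
exists [::], h; split=> //.
by rewrite g6 addn1 addn1 -add1n -drop_drop encode_history drop1.
Qed.

Lemma scan_turns_correct i j reg :
  reg 3 = i -> reg 4 = j -> reg 14 = 1 -> scan_inv i j reg (size h) reg ->
  halts inp (While 5 scan_turn) reg (size h * 22 + 1) (fun reg' =>
    [/\ reg' 7 = cell_count h i j, reg' 8 = breaker_count h i,
        reg' 9 = box_count h i & same_on [:: 0; 1; 2; 3; 4; 14; 15] reg' reg]).
Proof.
move=> <- <- r14 inv.
have loop := halts_while (T := 21) (r := 5) (c := scan_turn) (inp := inp)
  (I := scan_inv (reg 3) (reg 4) reg).
apply: halts_weaken (loop _ _ _ _ inv) (leqnn _) _.
- by move=> k g [? [? []]].
- by move=> k g _; exact: scan_turn_correct.
- by move=> g [h1 [[|m h2] [hE _ //= _ _]]]; rewrite hE cats0.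
Qed.

Lemma compute_score_correct i j reg :
  reg 7 = cell_count h i j -> reg 8 = breaker_count h i ->
  reg 9 = box_count h i ->
  halts inp compute_score reg 6 (fun reg' =>
    reg' 10 = score h i j /\ same_on [:: 0; 1; 2; 3; 4; 14; 15] reg' reg).
Proof.
move=> r7 r8 r9.
pose Q v (g : registers) := [/\ g 7 = reg 7, g 8 = reg 8, g 10 = v
  & same_on [:: 0; 1; 2; 3; 4; 14; 15] g reg].
have set_if g v v' r : Q v g -> r \in [:: 7; 8] ->
    halts inp (If r (block (Const 10 v') [::]) (block (Const 11 0) [::])) g 2
      (Q (if g r != 0 then v' else v)).
  move=> [g7 g8 g10 gs] r78; apply: halts_if => gr; rewrite gr;
    apply: (@halts_block _ 17) => // g'; run_block;
    move=> [e0 e1 e2 e3 e4 _ _ e7 e8 _ e10 _ _ _ e14 e15 _];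
    (split; [congruence|congruence|by rewrite e10 ?g10|]);
    apply: same_on_trans gs => r'; same_tac.
apply: (@halts_seq _ _ _ _ 2 4 (Q (2 + box_count h i))).
  apply: (@halts_block _ 17) => // g; run_block.
  move=> [e0 e1 e2 e3 e4 _ _ e7 e8 _ e10 _ _ _ e14 e15 _].
  by split; [congruence..|move=> r; same_tac].
move=> g1 q1.
apply: (@halts_seq _ _ _ _ 2 2
  (Q (if breaker_count h i != 0 then 1 else 2 + box_count h i))).
  by have [_ g8 _ _] := q1; rewrite -r8 -g8; apply: set_if.
move=> g2 q2; have [g7 _ _ _] := q2.
apply: halts_weaken (set_if _ _ 0 7 q2 isT) (leqnn _) _ => g3 [_ _ g10 gs].
by split=> //; rewrite g10 /score g7 r7.
Qed.

Lemma keep_best_correct (x : board a) V reg :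
  scan_state (tag x) V reg -> reg 4 = tagged x ->
  reg 10 = score h (tag x) (tagged x) ->
  halts inp keep_best reg 5 (fun reg' =>
    scan_state (tag x) (fun y => V y \/ y = x) reg' /\ reg' 4 = tagged x).
Proof.
move=> [r3 r14 r15 [bestx besty]] r4 r10.
pose Q (g : registers) := g 11 = reg 10 - reg 2 /\
  same_on [:: 0; 1; 2; 3; 4; 10; 14; 15] g reg.
apply: (@halts_seq _ _ _ _ 1 4 Q).
  apply: (@halts_block _ 17) => // g; run_block.
  move=> [e0 e1 e2 e3 e4 _ _ _ _ _ e10 e11 _ _ e14 e15 _]; split=> //.
  by move=> r; same_tac.
move=> g [g11 same]; apply: halts_if => gain.
  apply: (@halts_block _ 17) => // g'; run_block.
  move=> [e0 e1 e2 e3 e4 _ _ _ _ _ e10 e11 _ _ e14 e15 _].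
  move: e0 e1 e2 e3 e4 e14 e15; rewrite !same // r3 r4 r10 r14 r15 !addn0.
  move=> e0 e1 e2 e3 e4 e14 e15; split=> //; split=> //; split.
    by right; exists x.
  move=> y; rewrite e2 => -[/besty|-> //]; move/leq_trans; apply.
  by move: gain; rewrite g11 r10 -lt0n subn_gt0 => /ltnW.
apply: (@halts_weaken _ _ _ 1 3 _ _ _ isT (fun=> id)).
apply: (@halts_block _ 17) => // g'; run_block.
move=> [e0 e1 e2 e3 e4 _ _ _ _ _ _ _ _ _ e14 e15 _].
move: e0 e1 e2 e3 e4 e14 e15; rewrite !same // r3 r4 r14 r15.
move=> e0 e1 e2 e3 e4 e14 e15; split=> //; split=> //.
split=> [|y]; first by rewrite e0 e1 e2.
rewrite e2 => -[/besty //|->].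
by move/eqP: gain; rewrite g11 subn_eq0 r10.
Qed.

Lemma scan_cell_correct (x : board a) V reg :
  scan_state (tag x) V reg -> reg 4 = (tagged x).+1 ->
  halts inp scan_cell reg (size h * 22 + 20) (fun reg' =>
    scan_state (tag x) (fun y => V y \/ y = x) reg' /\ reg' 4 = tagged x).
Proof.
move=> st r4.
have state_same g g' : same_on [:: 0; 1; 2; 3; 4; 14; 15] g' g ->
    scan_state (tag x) V g -> g 4 = tagged x ->
    scan_state (tag x) V g' /\ g' 4 = tagged x.
  move=> same gst g4; split; last by rewrite same.
  apply: scan_state_same gst => r rs; apply: same.
  by move: r rs; apply/allP.
rewrite (_ : size h * 22 + 20 = 8 + ((size h * 22 + 1) + (6 + 5))); last by lia.
apply: halts_seq (init_scan_correct st r4) _ => g1 [st1 g14 inv1].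
have [s3 s14 _ _] := st1.
apply: halts_seq (scan_turns_correct s3 g14 s14 inv1) _ => g2 [g27 g28 g29 same2].
have [st2 g24] := state_same _ _ same2 st1 g14.
apply: halts_seq (compute_score_correct g27 g28 g29) _ => g3 [g310 same3].
have [st3 g34] := state_same _ _ same3 st2 g24.
exact: keep_best_correct.
Qed.

Lemma scan_state_sub i (V V' : board a -> Prop) reg :
  (forall y, V' y -> V y) -> scan_state i V reg -> scan_state i V' reg.
Proof.
by move=> VV' [? ? ? [? best]]; split=> //; split=> // y /VV' /best.
Qed.

(** Boxes and cells are visited in decreasing order, so the scanned cells always form a final
    segment of the lexicographic order. *)
Lemma scan_box_correct (i : 'I_n) reg :
  scan_state i.+1 (fun y => i < tag y) reg ->
  halts inp scan_box reg (3 + (a i * (size h * 22 + 21) + 1))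
    (scan_state i (fun y => i <= tag y)).
Proof.
move=> [r3 r14 r15 best].
pose I j (g : registers) := g 4 = j /\
  scan_state i (fun y => i < tag y \/ (tag y = i /\ j <= tagged y)) g.
apply: (@halts_seq _ _ _ _ 3 _ (I (a i))).
  apply: (@halts_block _ 17) => // g; run_block.
  rewrite r14 r3 r15 subn1 addn1 => -[e0 e1 e2 e3 e4 _ _ _ _ _ _ _ _ _ e14 e15 _].
  have gi : input_value inp i.+1 = a i.
    by rewrite /input_value encode_box // box_sizeE.
  split; first by rewrite e4; exact: gi.
  split=> //; case: best => [bestx best]; split; first by rewrite e0 e1 e2.
  move=> y; rewrite e2 => -[/best //|[yi]].
  by rewrite leqNgt -yi ltn_ord.
move=> g Ig.
have loop := halts_while (T := size h * 22 + 20) (r := 4) (c := scan_cell)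
  (inp := inp) (I := I).
rewrite (addnS _ 20).
apply: halts_weaken (loop _ _ _ _ Ig) (leqnn _) _.
- by move=> j g' [].
- move=> j g' ji [g4 st].
  pose x : board a := Tagged (fun k : 'I_n => 'I_(a k)) (Ordinal ji).
  apply: halts_weaken (@scan_cell_correct x _ g' st g4) (leqnn _) _.
  move=> g'' [st' g4']; split=> //; apply: scan_state_sub st' => y.
  case=> [iy|[yi]]; first by left; left.
  rewrite leq_eqVlt => /orP[/eqP jy|jy]; last by left; right.
  right; rewrite /x; case: y yi jy => i' j' /= e; subst i' => e.
  by congr (Tagged _ _); apply: val_inj; rewrite /= e.
- move=> g' [_]; apply: scan_state_sub => y.
  rewrite leq_eqVlt => /orP[/eqP/val_inj iy|iy]; last by left.
  by right.
Qed.

Lemma best_move_program_correct (S : nat) : ongoing h -> board_size a <= S ->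
  exists (x : board a) (t : nat) (reg : registers),
    [/\ best_move h x, t <= S * (S * (S * 22 + 21) + 5) + 3,
        exec inp best_move_program (fun=> 0) t reg, reg 0 = tag x
      & reg 1 = tagged x].
Proof.
move=> /andP[uh sh] leS.
pose I i (g : registers) := scan_state i (fun y => i <= tag y) g.
have size_h : size h <= S.
  by apply: leq_trans leS; rewrite (leq_trans (ltnW sh)) // leq_addl.
have a_le i : a i <= S.
  apply: leq_trans leS; apply: leq_trans (leq_addl _ _).
  rewrite -(card_ord (a i)).
  apply: (@leq_card _ (board a) (Tagged (fun k : 'I_n => 'I_(a k)) (i := i))).
  by move=> j1 j2 /eqP; rewrite eq_Tagged /= => /eqP.
have [t [reg [tT e st]]] : halts inp best_move_program (fun=> 0)
    (2 + (n * (S * (S * 22 + 21) + 5) + 1)) (I 0).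
  apply: (@halts_seq _ _ _ _ _ _ (I n)).
    apply: (@halts_block _ 17) => // g; run_block.
    move=> [e0 e1 e2 e3 e4 _ _ _ _ _ _ _ _ _ e14 e15 _].
    split=> //; split; first by left.
    by move=> y; rewrite leqNgt ltn_ord.
  move=> g Ig.
  have loop := halts_while (T := S * (S * 22 + 21) + 4) (r := 3) (c := scan_box)
    (inp := inp) (I := I).
  rewrite (addnS _ 4).
  apply: (loop _ _ _ _ Ig) => [i g' []//|i g' i_n st].
  apply: halts_weaken (@scan_box_correct (Ordinal i_n) g' st) _ (fun _ => id) => //.
  have := leq_mul (a_le (Ordinal i_n)) (leq_add (leq_mul size_h (leqnn 22)) (leqnn 21)).
  lia.
have [_ _ _ [bestx besty]] := st.
(* An ongoing game has a free cell, whose positive score rules out the initial case [reg 2 = 0]. *)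
have [y yh] : exists y : board a, y \notin claimed h.
  apply/existsP; rewrite -negb_forall; apply: contraL sh => /forallP all_h.
  rewrite -leqNgt -(size_map snd) cardE.
  by apply: uniq_leq_size (enum_uniq _) _ => y _; exact: all_h.
have r2 : 0 < reg 2 by apply: leq_trans (besty y _) => //; rewrite score_gt0.
case: bestx => [r20|[x [r0 r1 rx]]]; first by rewrite r20 in r2.
exists x, t, reg; split=> //.
  by split; rewrite -rx // => z; exact: besty.
apply: leq_trans tT _; have n_le : n <= S by apply: leq_trans leS; exact: leq_addr.
have := leq_mul n_le (leqnn (S * (S * 22 + 21) + 5)); lia.
Qed.

End Correctness.

(** * The strategy given by the program *)

Definition time_bound : {poly nat} :=
  'X * ('X * ('X * 22%N%:P + 21%N%:P) + 5%N%:P) + 3%N%:P.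

Lemma time_boundE (s : nat) :
  time_bound.[s] = (s * (s * (s * 22 + 21) + 5) + 3)%N.
Proof. by rewrite /time_bound !(hornerD, hornerM, hornerX, hornerC). Qed.

Definition outputs {n : nat} {a : 'I_n -> nat} (h : history a) (w : seq bool)
    (x : board a) : Prop :=
  exists (t : nat) (reg : registers),
    [/\ (t <= time_bound.[board_size a])%N,
        exec (encode h w) best_move_program (fun=> 0%N) t reg,
        reg 0%N = tag x :> nat
      & reg 1%N = tagged x :> nat].

Definition computes {n : nat} {a : 'I_n -> nat} (h : history a)
    (f : time_bound.[board_size a].-tuple bool -> board a) : Prop :=
  forall w, best_move h (f w) /\ outputs h w (f w).

Lemma ex_computes {n : nat} {a : 'I_n -> nat} (h : history a) :
  ongoing h -> exists f, computes h f.
Proof.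
move=> oh.
have /choice[f cf] (w : time_bound.[board_size a].-tuple bool) :
    exists x, best_move h x /\ outputs h w x.
  have [x [t [reg [bx tT e r0 r1]]]] :=
    best_move_program_correct w oh (leqnn (board_size a)).
  by exists x; split=> //; exists t, reg; split=> //; rewrite time_boundE.
by exists f.
Qed.

(* The program is deterministic, but taking the law of its output over all random
   bits spares a proof that this output does not depend on them. *)
Definition best_maker (R : realType) (n : nat) (a : 'I_n -> nat) :
    strategy R a := fun h x =>
  if pselect (ongoing h) is left oh then
    #|[set w | sval (cid (ex_computes oh)) w == x]%SET|%:R /
      2%:R ^+ time_bound.[board_size a]
  else 0.

Lemma best_makerE (R : realType) n (a : 'I_n -> nat) (h : history a) :
  ongoing h -> exists2 f, computes h f & forall x,
    best_maker R h x =
      #|[set w | f w == x]%SET|%:R / 2%:R ^+ time_bound.[board_size a].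
Proof.
move=> oh; rewrite /best_maker; case: pselect => // oh'.
by case: cid => f cf /=; exists f.
Qed.

Lemma best_maker_best (R : realType) n (a : 'I_n -> nat) (h : history a) x :
  ongoing h -> best_maker R h x != 0 -> best_move h x.
Proof.
move=> /(best_makerE R)[f cf ->].
case: (set_0Vmem [set w | f w == x]%SET) => [->|[w]].
  by rewrite cards0 mul0r eqxx.
by rewrite inE => /eqP <- _; have [] := cf w.
Qed.

Lemma best_maker_legal (R : realType) n (a : 'I_n -> nat) :
  legal (@best_maker R n a).
Proof.
move=> h oh; split=> [x||x xh].
- by have [f _ ->] := best_makerE R oh; rewrite divr_ge0 // exprn_ge0.
- have [f _ fE] := best_makerE R oh.
  under eq_bigr => x _ do rewrite fE.
  rewrite -mulr_suml -natr_sum.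
  (* The fibres of [f] partition the set of all bit strings. *)
  have -> : (\sum_x #|[set w | f w == x]%SET| = 2 ^ time_bound.[board_size a])%N.
    rewrite -card_bool -card_tuple -sum1_card (partition_big f predT) //=.
    by apply: eq_bigr => x _; rewrite -sum1_card; apply: eq_bigl => w; rewrite inE.
  by rewrite natrX mulfV // expf_neq0 // pnatr_eq0.
- apply/eqP/negPn/negP => /(best_maker_best oh) /best_move_unclaimed.
  by rewrite xh.
Qed.

Lemma best_maker_polynomial_time (R : realType) :
  polynomial_time (@best_maker R).
Proof.
exists best_move_program, time_bound => n a h oh l.
by have [f cf fE] := best_makerE R oh; exists f; split=> // w; have [] := cf w.
Qed.

(** * Asymptotics and conclusion *)

(** Take logarithms after multiplying by the positive [- ln (1 - p)]; the left-hand side is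
    [n ^ (c - 1)]. *)
Lemma ln_small_boxes (R : realType) (n b : nat) (p c : R) :
  0 < p < 1 -> (0 < n)%N ->
  b%:R <= (1 - c) * ln (n%:R : R) / - ln (1 - p) ->
  expR ((c - 1) * ln n%:R) <= (1 - p) ^+ b.
Proof.
move=> /andP[p0 p1] n0 bP.
have q0 : 0 < 1 - p by rewrite subr_gt0.
have lnq : 0 < - ln (1 - p) by rewrite oppr_gt0 ln_lt0 // q0 gtrBl.
move: bP; rewrite ler_pdivlMr // => bP.
rewrite -[X in X ^+ b](lnK q0) -expRM_natl ler_expR mulrC; lra.
Qed.

(** For positive [n] this is [exp (- n ^ eps)]. It depends on neither [p], the boxes nor Breaker, so
    the final bound is uniform in them. *)
Definition failure (R : realType) (eps : R) (n : nat) : R :=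
  expR (- expR (eps * ln n%:R)).

Lemma failure_cvg0 (R : realType) (eps : R) :
  0 < eps -> failure eps @ \oo --> (0 : R).
Proof.
move=> eps_gt0; apply/cvgrPdist_lt => e e0; near=> n.
rewrite sub0r normrN /failure ger0_norm ?expR_ge0 // expRN.
rewrite invf_plt ?posrE ?expR_gt0 //.
(* This threshold makes [n ^ eps] exceed [1 / e]; since [exp y > y], that is more than enough. *)
have n_gt : expR (- ln e / eps) < n%:R by near: n; exact: nbhs_infty_gtr.
have n0 : 0 < n%:R :> R by apply: lt_trans n_gt; exact: expR_gt0.
have : - ln e < eps * ln n%:R.
  by rewrite mulrC -ltr_pdivrMr // -ltr_expR lnK.
rewrite -ltr_expR expRN lnK // => /ltW /le_lt_trans; apply.
by have := expR_ge1Dx (expR (eps * ln n%:R)); lra.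
Unshelve. all: by end_near.
Qed.

Theorem theorem1p3 (R : realType) (eps : R) (eps_gt0 : 0 < eps) :
  exists maker : forall (n : nat) (a : 'I_n -> nat), strategy R a,
    [/\ forall (n : nat) (a : 'I_n -> nat), legal (maker n a),
        polynomial_time maker
      & exists delta : nat -> R,
          delta @ \oo --> (0 : R) /\
          \forall n \near \oo,
            forall (p : R) (a : 'I_n -> nat),
              0 < p < 1 ->
              (forall i : 'I_n,
                 (a i)%:R <= (1 - eps) * ln (n%:R : R) / - ln (1 - p)) ->
              forall breaker : strategy R a, legal breaker ->
                1 - delta n <= maker_win_prob p (maker n a) breaker].
Proof.
exists (@best_maker R); split.
- exact: best_maker_legal.
- exact: best_maker_polynomial_time.
exists (failure eps); split; first exact: failure_cvg0.
near=> n => p a p01 small breaker legal_breaker.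
have n0 : (0 < n)%N by near: n; exact: nbhs_infty_gt.
have /andP[p0 p1] := p01.
(* The largest box, which exists because [n > 0], supplies the common bound [b]. *)
have [|k ak] := @bigop.eq_bigmax 'I_n a; first by rewrite card_ord.
have max_ge i : (a i <= a k)%N by rewrite -ak leq_bigmax.
apply: le_trans (maker_win_prob_ge p0 p1 max_ge (@best_maker_legal R n a)
  legal_breaker (@best_maker_best R n a)).
rewrite lerD2l lerN2.
have q0 : 0 <= 1 - p by rewrite subr_ge0 ltW.
have risk_ge0 : 0 <= 1 - (1 - p) ^+ a k.
  by rewrite subr_ge0 exprn_ile1 // gerBl ltW.
have := ln_small_boxes p01 n0 (small k); set y := expR _ => yq.
have risk_le : 1 - (1 - p) ^+ a k <= expR (- y).
  by have := expR_ge1Dx (- y); lra.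
apply: (le_trans (lerXn2r n risk_ge0 (expR_ge0 _) risk_le)).
rewrite -expRM_natl /failure ler_expR mulrN lerN2 /y.
(* Writing [n] as [exp (ln n)] turns [n * n ^ (eps - 1)] into [n ^ eps]. *)
rewrite -[X in _ <= X * _]lnK ?posrE ?ltr0n // -expRD ler_expR.
by rewrite mulrBl mul1r addrC subrK.
Unshelve. all: by end_near.
Qed.
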